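(* Let $F:\mathbb{R}^n\rightrightarrows\mathbb{R}^q$ be a set-valued map, and suppose: (i) $F$ is polyhedral convex with nonempty domain; (ii) the natural ordering cone $K$ of $F$ equals $G(0)$, where $G$ is the recession function of $F$; (iii) the decision-making steps in the optimizer design algorithm applied to $F$ are qualified, with at most finitely many exceptions. Then the optimizer design algorithm is correct and finite. That is: whenever a decision-making step has to be executed, a qualified choice is possible; and every run of the algorithm in which all but at most finitely many decision-making steps are qualified terminates after finitely many steps and returns an optimizer of $F$.
   Context: A set-valued map $F:\mathbb{R}^n\rightrightarrows\mathbb{R}^q$ assigns to each $x\in\mathbb{R}^n$ a (possibly empty) subset $F(x)\subseteq\mathbb{R}^q$. Its graph is $\operatorname{gr}F=\{(x,y)\in\mathbb{R}^n\times\mathbb{R}^q : y\in F(x)\}$ and its domain is $\operatorname{dom}F=\{x\in\mathbb{R}^n : F(x)\neq\emptyset\}$. $F$ is polyhedral convex if $\operatorname{gr}F$ is a convex polyhedron (a finite intersection of closed half-spaces). A point $\bar x\in\mathbb{R}^n$ is an optimizer of $F$ if there is no $x\in\mathbb{R}^n$ with $F(x)\supsetneq F(\bar x)$. Recession function: for $F$ polyhedral convex with nonempty domain, $G:\mathbb{R}^n\rightrightarrows\mathbb{R}^q$, $G(x)=\{y\in\mathbb{R}^q : (x,y)\in 0^+\operatorname{gr}F\}$, where $0^+Q$ is the recession cone of a convex set $Q$. Natural ordering cone: $K=\{y\in\mathbb{R}^q : \exists x\in\mathbb{R}^n,\ y\in G(x),\ 0\in G(x)\}$. Value function: $v_F:2^{\mathbb{R}^q}\to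 2^{\mathbb{R}^q}$, $v_F(Y)=\{z\in\mathbb{R}^q : \exists x\in\mathbb{R}^n,\ z\in F(x),\ Y\subseteq F(x)\}$. A set $Z\subseteq\mathbb{R}^q$ is a fixed point of $v_F$ if $Z=v_F(Z)$. A set $Y\subseteq\mathbb{R}^q$ generates a fixed point of $v_F$ if there is a fixed point $Z$ of $v_F$ with $v_F(Y)=v_F(Z)$. Optimizer design algorithm (input: $F$ with $\operatorname{dom}F\neq\emptyset$): start with $Y:=\emptyset$. While $Y$ does not generate a fixed point of $v_F$, perform a decision-making step: choose some $y\in v_F(Y)$ (the choice is arbitrary and made by a decision maker) and replace $Y$ by $Y\cup\{y\}$. After the loop, determine some $x\in\mathbb{R}^n$ with $v_F(Y)=F(x)$ and return $x$. Under assumption (i), $v_F(Y)$ is a convex polyhedron for each finite $Y$. A decision-making step choosing $y\in v_F(Y)$ is called qualified if $y$ belongs to a minimal (with respect to $\subseteq$) face $S$ of the convex polyhedron $v_F(Y)$ such that $S\cap Y=\emptyset$. Here faces are nonempty faces, so the minimal faces are the vertices if $v_F(Y)$ has a vertex, and in general are translates of its lineality space. *)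

(* Defs.v *)
From mathcomp Require Import all_boot all_order all_algebra.
From mathcomp Require Import all_classical reals convex.

Set Implicit Arguments.
Unset Strict Implicit.
Unset Printing Implicit Defensive.

Import Order.TTheory GRing.Theory Num.Theory.

Local Open Scope classical_set_scope.
Local Open Scope ring_scope.

Section ConvexSets.
Context {R : realType} {d : nat}.
Implicit Types (P Q S : set 'rV[R]_d).

Definition closed_halfspace (H : set 'rV[R]_d) : Prop :=
  exists (a : 'cV[R]_d) (b : R),
    a != 0 /\ H = [set x | (x *m a) 0 0 <= b].

(* m = 0 is allowed, so the whole space is a convex polyhedron. *)
Definition convex_polyhedron P : Prop :=
  exists (m : nat) (H : 'I_m -> set 'rV[R]_d),
    (forall i, closed_halfspace (H i)) /\ P = \bigcap_i H i.

Definition recession_cone Q : set 'rV[R]_d :=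
  [set u | forall x t, Q x -> 0 <= t -> Q (x + t *: u)].

(* Rockafellar's definition of the faces of a convex set, the empty face being
   excluded. *)
Definition face P S : Prop :=
  [/\ S !=set0, convex_set S, S `<=` P &
      forall x y (t : R), P x -> P y -> 0 < t < 1 ->
        S ((1 - t) *: x + t *: y) -> S x /\ S y].

Definition minimal_face P S : Prop :=
  face P S /\ forall S', face P S' -> S' `<=` S -> S' = S.

End ConvexSets.

Section SetValuedMaps.
Context {R : realType} {n q : nat}.
Variable F : 'rV[R]_n -> set 'rV[R]_q.
Implicit Types (x : 'rV[R]_n) (y : 'rV[R]_q) (Y Z : set 'rV[R]_q).

(* R^n x R^q is identified with R^(n + q); the pair (x, y) is row_mx x y. *)
Definition graph : set 'rV[R]_(n + q) :=
  [set z | F (lsubmx z) (rsubmx z)].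

Definition domain : set 'rV[R]_n := [set x | F x !=set0].

Definition polyhedral_convex : Prop := convex_polyhedron graph.

Definition optimizer x : Prop := ~ exists x', F x `<` F x'.

Definition recession_function x : set 'rV[R]_q :=
  [set y | recession_cone graph (row_mx x y)].

Definition natural_ordering_cone : set 'rV[R]_q :=
  [set y | exists x, recession_function x y /\ recession_function x 0].

Definition value_function Y : set 'rV[R]_q :=
  [set z | exists x, F x z /\ Y `<=` F x].

Definition fixed_point Z : Prop := Z = value_function Z.

Definition generates_fixed_point Y : Prop :=
  exists Z, fixed_point Z /\ value_function Y = value_function Z.

Definition qualified Y y : Prop :=
  exists S, [/\ minimal_face (value_function Y) S, S `&` Y = set0 & S y].

(* The values that the variable Y of the algorithm can take when the loop
   condition is evaluated, for arbitrary decisions. *)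
Inductive reachable : set 'rV[R]_q -> Prop :=
| reachable_init : reachable set0
| reachable_step Y y :
    reachable Y -> ~ generates_fixed_point Y -> value_function Y y ->
    reachable (Y `|` [set y]).

(* The value of Y after k steps, the decision of step i being y i. *)
Fixpoint state (y : nat -> 'rV[R]_q) (k : nat) : set 'rV[R]_q :=
  if k is k'.+1 then state y k' `|` [set y k'] else set0.

(* The loop condition held at all of the tests 0, ..., k, so that step k is
   carried out. *)
Definition executed (y : nat -> 'rV[R]_q) (k : nat) : Prop :=
  forall j, (j <= k)%N -> ~ generates_fixed_point (state y j).

(* Terminating and nonterminating runs are both encoded by an infinite sequence
   of decisions, whose terms are arbitrary from termination on. *)
Definition run (y : nat -> 'rV[R]_q) : Prop :=
  forall k, executed y k -> value_function (state y k) (y k).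

Definition unqualified_steps (y : nat -> 'rV[R]_q) : set nat :=
  [set k | executed y k /\ ~ qualified (state y k) (y k)].

Definition stops_at (y : nat -> 'rV[R]_q) (N : nat) : Prop :=
  (forall j, (j < N)%N -> ~ generates_fixed_point (state y j)) /\
  generates_fixed_point (state y N).

(* The points which may be returned when the loop ends with the set Y. *)
Definition output Y : set 'rV[R]_n := [set x | value_function Y = F x].

End SetValuedMaps.

(* Main.v *)
Require Import Defs.
From mathcomp Require Import all_boot all_order all_algebra.
From mathcomp Require Import all_classical reals convex.
From mathcomp Require Import interval_inference ring lra.

Set Implicit Arguments.
Unset Strict Implicit.
Unset Printing Implicit Defensive.

Import Order.TTheory GRing.Theory Num.Theory.

Local Open Scope classical_set_scope.
Local Open Scope ring_scope.

(** Write v for the value function of F and K for the natural ordering cone.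

Correctness is formal.  The set Y generates a fixed point exactly when v(Y) is
itself a fixed point of v; such a set is a value F(x), and a value F(x') strictly
above F(x) would lie in v(F(x)) = F(x).

The rest depends on a description of v(Y) by linear inequalities.  If the graph
of F is given by A x + B y <= b, then for a finite nonempty Y the condition
Y `<=` F(x) reads A x <= c, where c i is the minimum of b i - B i y over y in Y.
Hence v(Y) is the projection to the z-space of the solution set of
A x + B z <= b, A x <= c, and Y enters only through the right-hand side.
Fourier-Motzkin elimination [fourier_motzkin] produces normals D which do not
depend on the right-hand side, so all the v(Y) are of the form D z <= d with the
same D, and every solution of D u <= 0 belongs to K [value_function_polyhedron].

Termination.  The inequalities active at a point of a polyhedron determine the
smallest face containing that point [active_face].  In a nonterminating run, let
step k be qualified by a face S of v(Y_k), and fix a later set Y_N.  Then y_k is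
in S, while the earlier decisions y_j lie in Y_k and therefore not in S; all
these points are in v(Y_N), a subset of v(Y_k).  So the inequalities of v(Y_N)
active at y_k differ from those active at each earlier y_j.  The number of
qualified steps is thus bounded by the number of subsets of the index set of D,
whatever N is: this is where the independence of D from Y matters.

Existence of a qualified choice.  Suppose every minimal face of v(Y) meets Y, and
choose x with Y `<=` F(x).  The convex set F(x) is stable under adding elements of
G(0) = K, which contains the recession directions of v(Y), and it meets every
minimal face of v(Y).  This forces v(Y) `<=` F(x)
[polyhedron_sub_of_minimal_faces], a form of the Minkowski decomposition of a
polyhedron into its minimal faces and its recession cone.  Then v(Y) = F(x) is a
fixed point, and no decision was required.  If Y is empty, the same lemma with
the empty set in place of F(x) shows that v(Y) has a minimal face. *)

(** * Linear functionals on row vectors *)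

Section Pairing.
Context {R : realType} {d : nat}.
Implicit Types (z w : 'rV[R]_d) (a : 'cV[R]_d).

Definition pairing z a : R := (z *m a) 0 0.

Lemma pairingD z w a : pairing (z + w) a = pairing z a + pairing w a.
Proof. by rewrite /pairing mulmxDl mxE. Qed.

Lemma pairingZ t z a : pairing (t *: z) a = t * pairing z a.
Proof. by rewrite /pairing -scalemxAl mxE. Qed.

Lemma pairingB z w a : pairing (z - w) a = pairing z a - pairing w a.
Proof. by rewrite -scaleN1r pairingD pairingZ mulN1r. Qed.

Lemma pairingDr z a b : pairing z (a + b) = pairing z a + pairing z b.
Proof. by rewrite /pairing mulmxDr mxE. Qed.

Lemma pairingZr t z a : pairing z (t *: a) = t * pairing z a.
Proof. by rewrite /pairing -scalemxAr mxE. Qed.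

Lemma pairing0 a : pairing 0 a = 0.
Proof. by rewrite /pairing mul0mx mxE. Qed.

Lemma pairing0r z : pairing z 0 = 0.
Proof. by rewrite /pairing mulmx0 mxE. Qed.

End Pairing.

Lemma pairing_row_mx (R : realType) (n q : nat) (x : 'rV[R]_n) (y : 'rV[R]_q)
    (a : 'cV[R]_(n + q)) :
  pairing (row_mx x y) a = pairing x (usubmx a) + pairing y (dsubmx a).
Proof. by rewrite /pairing -{1}[a]vsubmxK mul_row_col mxE. Qed.

(** * Fourier-Motzkin elimination *)

Section LineElimination.
Context {R : realType} {I : finType}.
Implicit Types (alpha r : I -> R).

(** Nonnegative multipliers for the inequalities k.1 and k.2 whose combination
cancels the variable with coefficients alpha.  They depend on alpha only, so that
elimination keeps the normals independent of the right-hand sides.  The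
pairs with alpha k.1 = 0 carry over the inequality k.1, in which the variable does
not occur. *)
Definition fm_weight alpha (k : I * I) : R * R :=
  if alpha k.1 == 0 then (1, 0)
  else if (0 < alpha k.1) && (alpha k.2 < 0) then (- alpha k.2, alpha k.1)
  else (0, 0).

(** A variable s is bounded below by the inequalities with alpha < 0 and above
by those with alpha > 0; the combined inequalities say that every lower bound is
below every upper bound, so the largest lower bound is a solution, or the smallest upper
bound if there is no lower one. *)
Lemma line_elimination alpha r :
  (exists s, forall i, s * alpha i <= r i) <->
  (forall k, 0 <= (fm_weight alpha k).1 * r k.1 + (fm_weight alpha k).2 * r k.2).
Proof.
split=> [[s hs] [i j]|H].
  rewrite /fm_weight /=; case: eqP => [a0|_] /=.
    by move: (hs i); rewrite a0; lra.
  case: ifP => [/andP[a0 b0]|_] /=; last by lra.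
  move: (hs i) (hs j); nra.
have H0 i : alpha i = 0 -> 0 <= r i.
  by move=> a0; move: (H (i, i)); rewrite /fm_weight /= a0 eqxx /=; lra.
have H1 i j : 0 < alpha i -> alpha j < 0 -> r j / alpha j <= r i / alpha i.
  move=> a0 b0; move: (H (i, j)); rewrite /fm_weight /= a0 b0 (gt_eqF a0) /= => h.
  by rewrite ler_pdivlMr // mulrAC ler_ndivrMr //; lra.
have [j0 bj0|noneg] := pickP (fun j => alpha j < 0).
  have [/= j1 bj1 max1] :=
    @Order.TotalTheory.arg_maxP _ _ _ j0 (fun j => alpha j < 0)
      (fun j => r j / alpha j) bj0.
  exists (r j1 / alpha j1) => i; have [ai|ai|ai] := ltgtP (alpha i) 0.
  - by rewrite -ler_ndivrMr //; exact: max1.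
  - by rewrite -ler_pdivlMr //; exact: H1.
  - by rewrite ai mulr0; exact: H0.
have [i0 ai0|nopos] := pickP (fun i => 0 < alpha i).
  have [/= i1 ai1 min1] :=
    @Order.TotalTheory.arg_minP _ _ _ i0 (fun i => 0 < alpha i)
      (fun i => r i / alpha i) ai0.
  exists (r i1 / alpha i1) => i; have [ai|ai|ai] := ltgtP (alpha i) 0.
  - by rewrite noneg in ai.
  - by rewrite -ler_pdivlMr //; exact: min1.
  - by rewrite ai mulr0; exact: H0.
exists 0 => i; rewrite mul0r; apply: H0.
by have := noneg i; have := nopos i; case: ltgtP.
Qed.

End LineElimination.

(** The projection of a polyhedron along x is a polyhedron.  The quantification
of b after D and Phi expresses that the normals D serve all right-hand sides; the
equation at 0 identifies the solutions of D u <= 0 with the projections of the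
recession directions. *)
Lemma fourier_motzkin (R : realType) (n q : nat) (I : finType)
    (A : I -> 'cV[R]_n) (B : I -> 'cV[R]_q) :
  exists (J : finType) (D : J -> 'cV[R]_q) (Phi : (I -> R) -> J -> R),
    Phi (fun=> 0) = (fun=> 0) /\
    forall b z, (exists x, forall i, pairing x (A i) + pairing z (B i) <= b i)
      <-> (forall j, pairing z (D j) <= Phi b j).
Proof.
elim: n => [|n IH] in I A B *.
  exists I, B, id; split=> // b z; split=> [[x h] i|h].
    by move: (h i); rewrite (thinmx0 x) pairing0 add0r.
  by exists 0 => i; rewrite pairing0 add0r.
pose alpha i := A i 0 0.
pose mu k := (fm_weight alpha k).1; pose nu k := (fm_weight alpha k).2.
pose A0 i : 'cV[R]_n := dsubmx (A i : 'cV_(1 + n)).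
have [J [D [Phi [Phi0 hPhi]]]] := IH _
  (fun k : I * I => mu k *: A0 k.1 + nu k *: A0 k.2)
  (fun k : I * I => mu k *: B k.1 + nu k *: B k.2).
exists J, D, (fun b => Phi (fun k => mu k * b k.1 + nu k * b k.2)); split.
  by rewrite -Phi0; congr Phi; apply/funext => k; rewrite !mulr0 addr0.
move=> b z; rewrite -hPhi.
have step (s : R) (x : 'rV[R]_n) i :
    pairing (row_mx s%:M x : 'rV_(1 + n)) (A i) = s * alpha i + pairing x (A0 i).
  rewrite (pairing_row_mx (s%:M) x) {1}/pairing mul_scalar_mx !mxE.
  congr (_ * A i _ _ + _).
  by apply/val_inj.
have elim_x (x : 'rV[R]_n) :
  (exists s, forall i, s * alpha i <= b i - (pairing x (A0 i) + pairing z (B i)))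
  <-> forall k, pairing x (mu k *: A0 k.1 + nu k *: A0 k.2)
       + pairing z (mu k *: B k.1 + nu k *: B k.2) <= mu k * b k.1 + nu k * b k.2.
  rewrite line_elimination; split=> h k; move: (h k);
    rewrite -/(mu k) -/(nu k) !pairingDr !pairingZr; nra.
split=> [[x h]|[x /elim_x [s h]]].
  exists (rsubmx (x : 'rV_(1 + n))); apply/elim_x.
  have xE : row_mx (x 0 0)%:M (rsubmx (x : 'rV_(1 + n))) = x :> 'rV_(1 + n).
    rewrite -[RHS](@hsubmxK _ 1 1 n x); congr row_mx.
    apply/matrixP => i' j'; rewrite !ord1 !mxE mulr1n; congr (x _ _).
    exact/val_inj.
  (* The eliminated variable is the first coordinate of x. *)
  exists (x 0 0) => i.
  by have := step (x 0 0) (rsubmx (x : 'rV_(1 + n))) i; rewrite xE; move: (h i); lra.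
exists (row_mx s%:M x : 'rV_(1 + n)) => i; rewrite step; move: (h i); lra.
Qed.

(** * Faces of polyhedra and active inequalities *)

Section Polyhedra.
Context {R : realType} {d : nat} {J : finType}.
Variables (D : J -> 'cV[R]_d) (b : J -> R).
Implicit Types (z w c p u : 'rV[R]_d) (C S : set 'rV[R]_d).

Definition polyhedron : set 'rV[R]_d := [set z | forall j, pairing z (D j) <= b j].

Definition active z : {set J} := [set j | pairing z (D j) == b j].

Lemma activeP z j : reflect (pairing z (D j) = b j) (j \in active z).
Proof. by rewrite inE; exact: eqP. Qed.

(** Going from p away from c, the inequalities active at p remain equalities
because they are active at both points.  Either nothing obstructs the ray, and
p - c is a recession direction, or the first obstruction is an inequality that
was not active at p. *)
Lemma ray_exit p c : polyhedron p -> polyhedron c -> active p \subset active c ->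
  (forall j, pairing (p - c) (D j) <= 0) \/
  exists s, [/\ 0 < s, polyhedron (p + s *: (p - c)) &
                active p \proper active (p + s *: (p - c))].
Proof.
move=> Pp Pc /fintype.subsetP pc; set u := p - c.
have u0 j : j \in active p -> pairing u (D j) = 0.
  move=> jp; have /activeP cj := pc _ jp; move/activeP: jp => pj.
  by rewrite pairingB pj cj subrr.
have [j0 uj0|nopos] := pickP (fun j => 0 < pairing u (D j)); last first.
  by left=> j; rewrite leNgt nopos.
right.
have [/= j1 uj1 min1] := @Order.TotalTheory.arg_minP _ _ _ j0
  (fun j => 0 < pairing u (D j))
  (fun j => (b j - pairing p (D j)) / pairing u (D j)) uj0.
set s := (_ / _) in min1; exists s.
have j1p : j1 \notin active p by apply/negP => /u0 u10; rewrite u10 ltxx in uj1.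
have s0 : 0 < s.
  rewrite divr_gt0 // subr_gt0 lt_neqAle Pp andbT.
  by apply: contra j1p; rewrite inE.
split=> //.
- move=> j; rewrite pairingD pairingZ.
  have [uj|uj] := ltP 0 (pairing u (D j)).
    by have := min1 j uj; rewrite ler_pdivlMr //; lra.
  by have := Pp j; nra.
- apply/properP; split.
    apply/fintype.subsetP => j jp; apply/activeP.
    by rewrite pairingD pairingZ (u0 _ jp) mulr0 addr0; apply/activeP.
  exists j1 => //; apply/activeP; rewrite pairingD pairingZ /s divfK ?gt_eqF //.
  by rewrite addrC subrK.
Qed.

Lemma point_between (s : R) p c : 0 < s ->
  p = (1 - (1 + s)^-1) *: c + (1 + s)^-1 *: (p + s *: (p - c)).
Proof.
move=> s0; have s1 : 1 + s != 0 by rewrite gt_eqF // addr_gt0.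
by apply/rowP => i; rewrite !mxE; field.
Qed.

Lemma weight_between (s : R) : 0 < s -> 0 < (1 + s)^-1 < 1.
Proof. by move=> s0; rewrite invr_gt0 addr_gt0 //= invf_lt1 ?addr_gt0 // ltrDl. Qed.

Definition segment_closed C :=
  forall x y (t : R), 0 < t < 1 -> C x -> C y -> C ((1 - t) *: x + t *: y).

Lemma segment_closed_convex C : segment_closed C -> convex_set C.
Proof.
move=> hC; apply/convex_setW => x y; rewrite !inE => Cx Cy k k0 k1.
have := hC y x k%:num; rewrite k0 k1 addrC => /(_ isT Cy Cx).
by rewrite inE.
Qed.

(** If every inequality active at p is active at w, the segment from w to p can
be prolonged inside the polyhedron beyond p.  So p is strictly between w and
another point of the polyhedron, and a face containing p contains w.  The set S
is allowed to be a face of a larger set P, because a face found at one step of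
the algorithm is compared with the smaller polyhedra of later steps. *)
Lemma active_face P S p w : polyhedron `<=` P -> face P S -> S p ->
  polyhedron p -> polyhedron w -> active p \subset active w -> S w.
Proof.
move=> DP [_ _ _ extS] Sp Pp Pw pw.
have [s s0 Pq] : exists2 s, 0 < s & polyhedron (p + s *: (p - w)).
  have [rec|[s [s0 Ps _]]] := ray_exit Pp Pw pw; last by exists s.
  (* On an unobstructed ray any positive length will do. *)
  by exists 1 => // j; rewrite scale1r pairingD; have := rec j; have := Pp j; lra.
have [] // := extS w (p + s *: (p - w)) (1 + s)^-1 (DP _ Pw) (DP _ Pq).
- exact: weight_between.
- by rewrite -point_between.
Qed.

(** For p in the polyhedron, this is the smallest face that contains p. *)
Definition active_at_least p : set 'rV[R]_d :=
  [set w | polyhedron w /\ active p \subset active w].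

Lemma face_active_at_least p : polyhedron p -> face polyhedron (active_at_least p).
Proof.
move=> Pp; split.
- by exists p; split.
- apply: segment_closed_convex => x y t /andP[t0 t1] [Px ax] [Py ay]; split.
    move=> j; rewrite pairingD !pairingZ; have := Px j; have := Py j; nra.
  apply/fintype.subsetP => j jp; apply/activeP; rewrite pairingD !pairingZ.
  have /activeP -> := fintype.subsetP ax _ jp.
  have /activeP -> := fintype.subsetP ay _ jp; ring.
- by move=> w [].
- move=> x y t Px Py /andP[t0 t1] [_ /fintype.subsetP a].
  suff eqs j : j \in active p -> pairing x (D j) = b j /\ pairing y (D j) = b j.
    by split; split=> //; apply/fintype.subsetP => j /eqs[? ?]; apply/activeP.
  move=> /a /activeP; rewrite pairingD !pairingZ.
  have := Px j; have := Py j => hy hx e.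
  by split; apply/eqP; rewrite eq_le ?hx ?hy /=; nra.
Qed.

(** Induction on the number of inequalities that are not active at p.  The
smallest face of p contains a point c of C: by assumption if it is minimal, and
otherwise by the induction hypothesis in a smaller face.  The ray from c through
p either never leaves the polyhedron, so that p - c is a recession direction, or
ends at a point with more active inequalities, which is in C by induction; then p
is between two points of C.  For C empty the lemma says that a nonempty
polyhedron has a minimal face. *)
Lemma polyhedron_sub_of_minimal_faces C :
  segment_closed C ->
  (forall u, (forall j, pairing u (D j) <= 0) -> forall c, C c -> C (c + u)) ->
  (forall S, minimal_face polyhedron S -> (S `&` C) !=set0) ->
  polyhedron `<=` C.
Proof.
move=> convC recC minC p.
have [m] := ubnP #|~: active p|; elim: m => // m IH in p *.
rewrite ltnS => pm Pp.
have IHp w : polyhedron w -> active p \proper active w -> C w.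
  move=> Pw pw; apply: IH => //; apply: leq_trans pm.
  by apply: proper_card; rewrite finset.properC.
have facep := face_active_at_least Pp.
have [c [[Pc pc] Cc]] : (active_at_least p `&` C) !=set0.
  have [minp|] := pselect (minimal_face polyhedron (active_at_least p)).
    exact: minC.
  move=> /not_andP[//|/existsNP[S /not_implyP[faceS /not_implyP[Sp /eqP neS]]]].
  have [[c Sc] _ _ _] := faceS; have [Pc pc] := Sp _ Sc.
  exists c; split=> //; apply: IHp => //; rewrite finset.properEneq pc andbT.
  apply: contra_neq neS => eqa; apply/seteqP; split=> // w [Pw pw].
  by apply: (active_face _ faceS Sc) => //; rewrite -eqa.
have [rec|[s [s0 Ps ps]]] := ray_exit Pp Pc pc.
  by have := recC _ rec _ Cc; rewrite addrC subrK.
rewrite (point_between p c s0); apply: convC => //; first exact: weight_between.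
exact: IHp.
Qed.

End Polyhedra.

(** * The value function *)

Section ValueFunction.
Context {R : realType} {n q : nat} (F : 'rV[R]_n -> set 'rV[R]_q).
Implicit Types (x : 'rV[R]_n) (y z u : 'rV[R]_q) (Y Z S : set 'rV[R]_q).

Lemma sub_value_function Y Z : Y `<=` Z -> value_function F Z `<=` value_function F Y.
Proof. by move=> YZ z [x [Fz ZF]]; exists x; split=> // y /YZ /ZF. Qed.

Lemma value_sub_value_function x Y : Y `<=` F x -> F x `<=` value_function F Y.
Proof. by move=> YF z Fz; exists x. Qed.

Lemma generates_value_function Y : generates_fixed_point F Y ->
  value_function F (value_function F Y) = value_function F Y.
Proof. by move=> [Z [fixZ ->]]; rewrite -!fixZ. Qed.

Lemma generates_of_value x Y :
  Y `<=` F x -> value_function F Y `<=` F x -> generates_fixed_point F Y.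
Proof.
move=> YF vF; have vE : value_function F Y = F x.
  by apply/seteqP; split=> //; exact: value_sub_value_function.
exists (F x); split; rewrite -vE; apply/seteqP; split.
- by rewrite vE; exact: value_sub_value_function.
- by apply: sub_value_function; rewrite vE.
- by rewrite vE; exact: value_sub_value_function.
- by apply: sub_value_function; rewrite vE.
Qed.

(** A fixed point v(Y) contains some z, since otherwise it would be the value of
v at the empty set, which is the union of all F(x).  The x which witnesses
z in v(v(Y)) satisfies v(Y) `<=` F(x), hence F(x) `<=` v(v(Y)) = v(Y). *)
Lemma output_of_generates Y : domain F !=set0 -> generates_fixed_point F Y ->
  output F Y !=set0.
Proof.
move=> [x0 [z0 Fz0]] /generates_value_function fixY.
have [z vz] : value_function F Y !=set0.
  apply/set0P/eqP => v0; move: fixY; rewrite v0 => /seteqP[+ _] => /(_ z0); apply.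
  by exists x0; split=> // y [].
have [x [_ vFx]] : value_function F (value_function F Y) z by rewrite fixY.
exists x; apply/seteqP; split=> //.
by rewrite -[X in _ `<=` X]fixY; exact: value_sub_value_function.
Qed.

Lemma optimizer_of_output Y x : generates_fixed_point F Y -> output F Y x ->
  optimizer F x.
Proof.
move=> /generates_value_function fixY vE [x' [FF' nF'F]]; apply: nF'F.
rewrite -vE -fixY; apply: value_sub_value_function.
by rewrite vE.
Qed.

Lemma reachable_finite Y : reachable F Y -> finite_set Y.
Proof.
elim=> [|{}Y y _ fY _ _]; first exact: finite_set0.
by rewrite finite_setU; split=> //; exact: finite_set1.
Qed.

Lemma reachable_sub_value Y : domain F !=set0 -> reachable F Y ->
  exists2 x, F x !=set0 & Y `<=` F x.
Proof.
move=> [x0 Fx0]; elim=> [|{}Y y _ _ _ [x [Fy YF]]]; first by exists x0.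
by exists x; [exists y|move=> z [/YF|->]].
Qed.

Lemma graph_inequalities : polyhedral_convex F ->
  exists (m : nat) (A : 'I_m -> 'cV[R]_n) (B : 'I_m -> 'cV[R]_q) (b : 'I_m -> R),
    forall x y, F x y <-> forall i, pairing x (A i) + pairing y (B i) <= b i.
Proof.
move=> [m [H [/boolp.choice [a /boolp.choice [b hab]] gE]]].
exists m, (fun i => usubmx (a i)), (fun i => dsubmx (a i)), b => x y.
have -> : F x y <-> graph F (row_mx x y) by rewrite /graph /= row_mxKl row_mxKr.
rewrite gE; split=> [h i|h i _].
  by rewrite -pairing_row_mx; move: (h i I); rewrite (hab i).2.
by rewrite (hab i).2 /= -/(pairing _ _) pairing_row_mx.
Qed.

(** The bound c is the minimum of g on Y, stated in the form in which it replaces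
the inequalities indexed by Y by a single one. *)
Lemma finite_lower_bound (g : 'rV[R]_q -> R) Y : finite_set Y -> Y !=set0 ->
  exists c, forall t, (forall y, Y y -> t <= g y) <-> t <= c.
Proof.
move=> /finite_seqP[s ->]; elim: s => [[y]//|y [_|y' s IH] _].
  exists (g y) => t; split=> [|ty y' /=]; first by apply; rewrite /= inE.
  by rewrite inE => /eqP ->.
have [|c hc] := IH; first by exists y'; rewrite /= inE eqxx.
exists (Num.min (g y) c) => t; rewrite le_min; split=> [h|/andP[ty /hc tc] w].
  rewrite h /= ?inE ?eqxx //; apply/hc => w sw; apply: h.
  by rewrite /= inE; apply/orP; right.
by rewrite /= inE => /orP[/eqP->|/tc].
Qed.

(** The constraints A x <= c with c obtained from Y express Y `<=` F(x), so v(Y)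
is a projection with normals independent of Y.  A recession direction u of it
lifts to some x for which (x, u) and (x, 0) are both recession directions of the
graph, which is membership in K. *)
Lemma value_function_polyhedron : polyhedral_convex F ->
  exists (J : finType) (D : J -> 'cV[R]_q),
    (forall Y, finite_set Y -> Y !=set0 ->
       exists d, value_function F Y = polyhedron D d) /\
    (forall u, (forall j, pairing u (D j) <= 0) -> natural_ordering_cone F u).
Proof.
move=> /graph_inequalities [m [A [B [b FE]]]].
pose glue (T : Type) (f g : 'I_m -> T) (k : 'I_m + 'I_m) :=
  match k with inl i => f i | inr i => g i end.
have [J [D [Phi [Phi0 PhiE]]]] :=
  fourier_motzkin (glue _ A A) (glue _ B (fun=> 0)).
exists J, D; split=> [Y finY Y0|u recu].
  have /boolp.choice [c hc] : forall i, exists c, forall t,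
      (forall y, Y y -> t <= b i - pairing y (B i)) <-> t <= c.
    by move=> i; exact: finite_lower_bound.
  exists (Phi (glue _ b c)); apply/seteqP; split=> z.
    move=> [x [/FE Fz YF]]; apply/PhiE; exists x => -[i|i] //=.
    rewrite pairing0r addr0; apply/hc => y /YF /FE /(_ i); lra.
  move=> /PhiE [x h]; exists x; split.
    by apply/FE => i; exact: (h (inl i)).
  move=> y Yy; apply/FE => i; have := h (inr i).
  by rewrite /= pairing0r addr0 => /hc /(_ _ Yy); lra.
(* Zero right-hand sides: the homogeneous system describes recession directions. *)
have [|x h] := (PhiE (fun=> 0) u).2; first by rewrite Phi0.
have rec v : (forall i, pairing x (A i) + pairing v (B i) <= 0) ->
    recession_function F x v.
  move=> h' w t; rewrite -[w]hsubmxK; set w1 := lsubmx w; set w2 := rsubmx w.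
  rewrite /graph /= scale_row_mx add_row_mx !row_mxKl !row_mxKr => /FE Fw t0.
  apply/FE => i; rewrite !pairingD !pairingZ; have := Fw i; have := h' i; nra.
exists x; split; apply: rec => i; first exact: (h (inl i)).
by rewrite pairing0 addr0; have := h (inr i); rewrite /= pairing0r addr0.
Qed.

(** The empty set needs a separate description: there is no constraint
A x <= c, and the recession directions of v(set0) need not lie in K. *)
Lemma value_function_set0_polyhedron : polyhedral_convex F ->
  exists (J : finType) (D : J -> 'cV[R]_q) (d : J -> R),
    value_function F set0 = polyhedron D d.
Proof.
move=> /graph_inequalities [m [A [B [b FE]]]].
have [J [D [Phi [_ PhiE]]]] := fourier_motzkin A B.
exists J, D, (Phi b); apply/seteqP; split=> z.
  by move=> [x [/FE Fz _]]; apply/PhiE; exists x.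
by move=> /PhiE [x h]; exists x; split=> //; apply/FE.
Qed.

Lemma value_segment_closed x : polyhedral_convex F -> segment_closed (F x).
Proof.
move=> /graph_inequalities [m [A [B [b FE]]]] y z t /andP[t0 t1] /FE Fy /FE Fz.
apply/FE => i; rewrite pairingD !pairingZ; have := Fy i; have := Fz i; nra.
Qed.

Lemma value_recession x y u : recession_function F 0 u -> F x y -> F x (y + u).
Proof.
move=> rec Fxy; have := rec (row_mx x y) 1.
rewrite /graph /= scale1r add_row_mx !row_mxKl !row_mxKr addr0.
exact.
Qed.

(** * Existence of qualified choices *)

Lemma exists_qualified Y :
  polyhedral_convex F -> domain F !=set0 ->
  natural_ordering_cone F = recession_function F 0 ->
  reachable F Y -> ~ generates_fixed_point F Y -> exists y, qualified F Y y.
Proof.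
move=> polF domF KG reachY ngenY; apply: contrapT => noq.
have meets S : minimal_face (value_function F Y) S -> (S `&` Y) !=set0.
  move=> minS; apply/set0P/eqP => SY0; apply: noq.
  have [[[y Sy] _ _ _] _] := minS; by exists y, S.
have [Y0|/eqP/set0P Y0] := pselect (Y = set0).
  have [J [D [d vE]]] := value_function_set0_polyhedron polF.
  have [x0 [z0 Fz0]] := domF.
  have : value_function F Y z0 by rewrite Y0; exists x0; split=> // y [].
  rewrite Y0 vE; apply: (polyhedron_sub_of_minimal_faces (C := set0)) => // S.
  by rewrite -vE -Y0 => /meets.
have [x Fx0 YF] := reachable_sub_value domF reachY.
apply/ngenY/(generates_of_value YF).
have [J [D [vE recD]]] := value_function_polyhedron polF.
have [d vY] := vE _ (reachable_finite reachY) Y0; rewrite vY.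
apply: polyhedron_sub_of_minimal_faces.
- exact: value_segment_closed.
- by move=> u /recD; rewrite KG => recu c; exact: value_recession.
- by rewrite -vY => S /meets [y [Sy /YF Fy]]; exists y.
Qed.

(** * Termination *)

Lemma sub_state (y : nat -> 'rV[R]_q) j k : (j <= k)%N -> state y j `<=` state y k.
Proof.
elim: k => [|k IH]; first by rewrite leqn0 => /eqP ->.
rewrite leq_eqVlt => /orP[/eqP -> //|/IH jk] z /jk ?; by left.
Qed.

Lemma mem_state (y : nat -> 'rV[R]_q) j k : (j < k)%N -> state y k (y j).
Proof. by move=> /(sub_state (y := y)); apply; right. Qed.

Lemma reachable_state (y : nat -> 'rV[R]_q) k : run F y ->
  (forall j, ~ generates_fixed_point F (state y j)) -> reachable F (state y k).
Proof.
move=> runy ngen; elim: k => [|k IH]; first exact: reachable_init.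
by apply: reachable_step => //; apply: runy => j _.
Qed.

(** After step k0 all decisions are qualified.  One step more than there are
subsets of the index set J is too many, as the active sets of these decisions are
pairwise distinct. *)
Lemma run_terminates (y : nat -> 'rV[R]_q) :
  polyhedral_convex F -> domain F !=set0 -> run F y ->
  finite_set (unqualified_steps F y) ->
  exists k, generates_fixed_point F (state y k).
Proof.
move=> polF domF runy finU; apply: contrapT => /forallNP ngen.
have exec k : executed F y k by move=> j _; exact: ngen.
have [k0 qual] : exists k0, forall k, (k0 <= k)%N -> qualified F (state y k) (y k).
  have /finite_seqP [s sE] := finU.
  exists (\max_(i <- s) i).+1 => k ks; apply: contrapT => nq.
  have : unqualified_steps F y k by split.
  by rewrite sE /= => /(leq_bigmax_seq (F := id)) /(_ isT); rewrite leqNgt ks.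
(* D is chosen before the horizon N, which depends on the number of its members. *)
have [J [D [vE _]]] := value_function_polyhedron polF.
pose m := #|{set J}|; pose N := (k0 + m.+1)%N.
have reachN := reachable_state N runy ngen.
have memN j : (j < N)%N -> value_function F (state y N) (y j).
  move=> jN; have [x _ YF] := reachable_sub_value domF reachN.
  by apply: (value_sub_value_function YF); apply: YF; exact: mem_state.
have [|d vN] := vE _ (reachable_finite reachN).
  by exists (y k0); apply: mem_state; rewrite /N addnS ltnS leq_addr.
have act_inj j k : (k0 <= k)%N -> (j < k)%N -> (k < N)%N ->
    active D d (y k) <> active D d (y j).
  move=> k0k jk kN eqa; have [S [[faceS _] SY Sy]] := qual _ k0k.
  suff : (S `&` state y k) (y j) by rewrite SY.
  split; last exact: mem_state.
  apply: (@active_face _ _ _ D d _ _ (y k) (y j) _ faceS) => //.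
  - by rewrite -vN; apply: sub_value_function; apply: sub_state; exact: ltnW.
  - by rewrite -vN; exact: memN.
  - by rewrite -vN; apply: memN; exact: ltn_trans kN.
  - by rewrite eqa.
pose f (i : 'I_m.+1) := active D d (y (k0 + i)%N).
have f_inj : injective f.
  move=> i j fij; apply/val_inj; have [ij|ji|//] := ltngtP (val i) (val j).
  - case: (@act_inj (k0 + i) (k0 + j))%N => //; first exact: leq_addr.
      by rewrite ltn_add2l.
    by rewrite /N ltn_add2l.
  - case: (@act_inj (k0 + j) (k0 + i))%N => //; first exact: leq_addr.
      by rewrite ltn_add2l.
    by rewrite /N ltn_add2l.
by have := leq_card f f_inj; rewrite card_ord ltnn.
Qed.

End ValueFunction.

(** * Correctness and finiteness of the algorithm *)

Theorem theorem5p2 (R : realType) (n q : nat) (F : 'rV[R]_n -> set 'rV[R]_q) :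
  polyhedral_convex F ->
  domain F !=set0 ->
  natural_ordering_cone F = recession_function F 0 ->
  (forall Y : set 'rV[R]_q,
      reachable F Y -> ~ generates_fixed_point F Y ->
      exists y : 'rV[R]_q, qualified F Y y) /\
  (forall y : nat -> 'rV[R]_q,
      run F y -> finite_set (unqualified_steps F y) ->
      exists N : nat,
        [/\ stops_at F y N,
            output F (state y N) !=set0 &
            forall x : 'rV[R]_n, output F (state y N) x -> optimizer F x]).
Proof.
move=> polF domF KG; split=> [Y|y runy finU]; first exact: exists_qualified.
have ex : exists k, `[< generates_fixed_point F (state y k) >].
  by have [k genk] := run_terminates polF domF runy finU; exists k; apply/asboolP.
exists (ex_minn ex); case: ex_minnP => N /asboolP genN minN; split.
- split=> // j jN /asboolP genj; by have := minN _ genj; rewrite leqNgt jN.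
- exact: output_of_generates.
- by move=> x; exact: optimizer_of_output.
Qed.
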